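(* Let $n\ge 2$, $N=\{1,\dots,n\}$, and let $F$ be a bargaining solution on $\mathcal{B}$. Then $F$ satisfies intermediate Pareto, homogeneity, anonymity, continuity, and IIA if and only if there exists a nonempty symmetric collection $\mathbb{C}$ of log-convex functions $c:\Delta\to\mathbb{R}_{++}\cup\{+\infty\}$ such that $\max_{c\in\mathbb{C}}\min_{w\in\Delta}c(w)=1$ and, for all $S\in\mathcal{B}$, $$F(S)=\operatorname*{arg\,max}_{x\in S}\left\{\max_{c\in\mathbb{C}}\min_{w\in\Delta}c(w)\prod_{i\in N}x_i^{w_i}\right\}.$$
   Context: Notation: $\mathbb{R}_+$ and $\mathbb{R}_{++}$ are the nonnegative and the positive reals. For $a,b\in\mathbb{R}^n$: $a\ge b$ means $a_i\ge b_i$ for all $i$; $a\gg b$ means $a_i>b_i$ for all $i$; $a>b$ means $a\ge b$ and $a\ne b$. For $\alpha\in\mathbb{R}$ and $S\subset\mathbb{R}^n$, $\alpha S=\{\alpha x\mid x\in S\}$. $\Pi$ is the set of permutations of $N$; $x^\pi=(x_{\pi(1)},\dots,x_{\pi(n)})$. A set $A\subset\mathbb{R}^n$ is symmetric if $A=\{x^\pi\mid x\in A\}$ for all $\pi\in\Pi$. Problems: $\mathcal{B}$ is the set of all nonempty sets $S\subset\mathbb{R}^n_+$ that are compact, comprehensive (for all $x,y\in\mathbb{R}^n_+$, if $x\in S$ and $y\le x$ then $y\in S$), and such that for every $i\in N$ there is $x\in S$ with $x_i>0$. Convexity is not assumed. A bargaining solution $F$ assigns to each $S\in\mathcal{B}$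 a nonempty subset $F(S)\subset S$. Axioms: - Intermediate Pareto: for all $S\in\mathcal{B}$ and $x\in F(S)$, there is no $y\in S$ with $y\gg x$; furthermore, for some $x'\in F(S)$ there is no $y'\in S$ with $y'>x'$. - Homogeneity: for all $S\in\mathcal{B}$ and $\alpha\in\mathbb{R}_{++}$, $F(\alpha S)=\alpha F(S)$. - Anonymity: for all symmetric $S\in\mathcal{B}$, if $x\in F(S)$, then $x^\pi\in F(S)$ for all $\pi\in\Pi$. - Continuity: for all $S\in\mathcal{B}$ and $x\in S$, if there exist sequences $\{S^k\}_{k\in\mathbb{N}}\subset\mathcal{B}$ and $\{x^k\}_{k\in\mathbb{N}}\subset\mathbb{R}^n$ with $x^k\in F(S^k)$ for all $k$, $S^k\to S$ in the Hausdorff topology, and $x^k\to x$, then $x\in F(S)$. - IIA (independence of irrelevant alternatives): for all $S,S'\in\mathcal{B}$ with $S'\subset S$, if $S'\cap F(S)\neq\emptyset$, then $F(S')=S'\cap F(S)$. Weights: $\Delta=\{w\in\mathbb{R}^n_+\mid\sum_{i\in N}w_i=1\}$. A function $c:\Delta\to\mathbb{R}_{++}\cup\{+\infty\}$ is log-convex if $\log c(\cdot)$, from $\{w\in\Delta\mid c(w)<+\infty\}$ to $\mathbb{R}$, is a convex function. A collection $\mathbb{C}$ of functions $c:\Delta\to\mathbb{R}_{++}\cup\{+\infty\}$ is symmetric if for all $c\in\mathbb{C}$ and $\pi\in\Pi$ the function $c^\pi$ defined by $c^\pi(w)=c(w^\pi)$ for all $w\in\Delta$ is also in $\mathbb{C}$.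 *)

(* Defs.v *)
From mathcomp Require Import all_boot all_order all_algebra all_fingroup.
From mathcomp Require Import all_classical all_reals all_analysis.
Import Order.TTheory GRing.Theory Num.Theory.
Import numFieldNormedType.Exports.

Set Implicit Arguments.
Unset Strict Implicit.
Unset Printing Implicit Defensive.

Local Open Scope classical_set_scope.
Local Open Scope ring_scope.

(* Players are the elements of 'I_n, vectors of R^n are row
   vectors, and x^pi = (x_(pi i))_i is [col_perm pi x]. *)

Section Bargaining.
Context {R : realType} {n : nat}.
Local Notation vec := 'rV[R]_n.
Implicit Types (x y w : vec) (S A : set vec) (F : set vec -> set vec).

Definition vle y x := forall i, y 0 i <= x 0 i.
Definition vll y x := forall i, y 0 i < x 0 i.
Definition vlt y x := vle y x /\ y <> x.

Definition orthant : set vec := [set x | forall i, 0 <= x 0 i].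

Definition symmetric_set A :=
  forall pi : 'S_n, A = [set col_perm pi x | x in A].

Definition comprehensive S :=
  forall x y, orthant x -> orthant y -> S x -> vle y x -> S y.

Definition problem S :=
  [/\ S !=set0, S `<=` orthant, compact S, comprehensive S &
      forall i, exists2 x, S x & 0 < x 0 i].

(* The values of [F] outside [problem] are irrelevant. *)
Definition solution F :=
  forall S, problem S -> F S !=set0 /\ F S `<=` S.

(* [edist] comes from the sup norm on row vectors. *)
Definition hausdorff_dist (A B : set vec) : \bar R :=
  maxe (ereal_sup [set edist_inf B a | a in A])
       (ereal_sup [set edist_inf A b | b in B]).

Definition intermediate_pareto F :=
  forall S, problem S ->
    (forall x, F S x -> ~ exists2 y, S y & vll x y) /\
    (exists2 x', F S x' & ~ exists2 y', S y' & vlt x' y').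

Definition homogeneity F :=
  forall S (alpha : R), problem S -> 0 < alpha ->
    F [set alpha *: x | x in S] = [set alpha *: x | x in F S].

Definition anonymity F :=
  forall S, problem S -> symmetric_set S ->
    forall x, F S x -> forall pi : 'S_n, F S (col_perm pi x).

Definition continuity F :=
  forall S x, problem S -> S x ->
    (exists (S_ : nat -> set vec) (x_ : nat -> vec),
      [/\ forall k, problem (S_ k),
          forall k, F (S_ k) (x_ k),
          hausdorff_dist (S_ k) S @[k --> \oo] --> 0%E &
          x_ k @[k --> \oo] --> x]) ->
    F S x.

Definition iia F :=
  forall S S', problem S -> problem S' -> S' `<=` S ->
    S' `&` F S !=set0 -> F S' = S' `&` F S.

Definition simplex : set vec := [set w | orthant w /\ \sum_i w 0 i = 1].

(* A function c : simplex -> R_++ U {+oo} is encoded by a total function into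
   \bar R, whose values outside of the simplex are irrelevant. *)
Implicit Types (c : vec -> \bar R) (C : set (vec -> \bar R)).

Definition positive_weight c := forall w, simplex w -> (0 < c w)%E.

Definition finite_dom c : set vec := [set w | simplex w /\ (c w < +oo)%E].

(* Convexity of a function includes that of its domain. *)
Definition log_convex c :=
  @convex_set R vec (finite_dom c) /\
  @convex_function R vec (finite_dom c) (fun w => ln (fine (c w))).

(* c^pi has to be in the collection up to its values outside of the simplex. *)
Definition symmetric_collection C :=
  forall c (pi : 'S_n), C c ->
    exists2 c', C c' & forall w, simplex w -> c' w = c (col_perm pi w).

(* c(w) prod_i x_i^(w_i), with 0^0 = 1 (as in [powR]) and +oo * 0 = +oo, so
   that a w with c(w) = +oo never matters in a minimum. The case distinction is
   needed because the product of \bar R has +oo * 0 = 0. *)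
Definition weighted_product x c w : \bar R :=
  if c w == +oo%E then +oo%E else (c w * (\prod_i x 0 i `^ w 0 i)%:E)%E.

Section MaxMin.
Variables (C : set (vec -> \bar R)) (V : (vec -> \bar R) -> vec -> \bar R).

Definition min_simplex c := ereal_inf [set V c w | w in simplex].
Definition maxmin := ereal_sup [set min_simplex c | c in C].

(* [maxmin] is a genuine max of minima: the min over the simplex is attained
   for every c in C, and so is the max over C. *)
Definition maxmin_attained :=
  (forall c, C c -> exists2 w, simplex w & V c w = min_simplex c) /\
  (exists2 c, C c & min_simplex c = maxmin).

End MaxMin.

Definition argmax S (U : vec -> \bar R) : set vec :=
  [set x | S x /\ forall y, S y -> (U y <= U x)%E].

End Bargaining.

(* Main.v *)
(* Both sides are equivalent to the existence of a monotone, symmetric function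
   [u] on the orthant, homogeneous of degree one and normalized by
   [u (1, ..., 1) = 1], such that [F S] is the set of maximizers of [u] on [S].

   From the axioms to [u]: let [u x] be the supremum of the [t > 0] for which [x]
   is chosen from the comprehensive hull of [x] and [(t, ..., t)]. By Pareto and
   IIA the choice switches exactly once as [t] grows, and comparing [x] in [S]
   with [y] in [S] through [S] united with the cube [[0, t]^n] shows that [F]
   maximizes [u]. When the maximum is 0, continuity reduces to a nearby problem.

   From [u] to the weights: for [u x > 0], the Leontief function
   [y |-> u x * min_i (y_i / x_i)] lies below [u] by monotonicity and
   homogeneity, touches it at [x], and is the minimum over [w] of
   [c_x w * prod_i y_i^(w_i)] for the log-affine weight
   [c_x w = u x / prod_i x_i^(w_i)].

   From the weights to the axioms: the max-min value [u] is monotone and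
   homogeneous, hence lower semicontinuous. Upper semicontinuity can fail at the
   boundary of the orthant for a general collection, but then some problem would
   have no maximizer, contrary to [F S] being nonempty. *)
Require Import Defs.
From mathcomp Require Import all_boot all_order all_algebra all_fingroup.
From mathcomp Require Import all_classical all_reals all_analysis.
From mathcomp Require Import lra.
Import Order.TTheory GRing.Theory Num.Theory.
Import numFieldNormedType.Exports.

Set Implicit Arguments.
Unset Strict Implicit.
Unset Printing Implicit Defensive.

Local Open Scope classical_set_scope.
Local Open Scope ring_scope.

(** * Boxes and problems *)

Section Orthant.
Context {R : realType} {n : nat}.
Local Notation vec := 'rV[R]_n.
Implicit Types (x y z p : vec) (S A : set vec) (d t : R).

Lemma vle_refl x : vle x x. Proof. by move=> i. Qed.

Lemma vle_trans y x z : vle x y -> vle y z -> vle x z.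
Proof. by move=> xy yz i; apply: le_trans (yz i). Qed.

Lemma orthant_vle x y : orthant x -> vle x y -> orthant y.
Proof. by move=> x0 xy i; apply: le_trans (xy i). Qed.

Lemma orthantZ x d : orthant x -> 0 <= d -> orthant (d *: x).
Proof. by move=> x0 d0 i; rewrite mxE mulr_ge0. Qed.

Lemma orthant_const d : 0 <= d -> orthant (const_mx d : vec).
Proof. by move=> d0 i; rewrite mxE. Qed.

Lemma orthant_perm x (pi : 'S_n) : orthant x -> orthant (col_perm pi x).
Proof. by move=> x0 i; rewrite mxE. Qed.

Lemma vle_shift x d : 0 <= d -> vle x (x + const_mx d).
Proof. by move=> d0 i; rewrite !mxE lerDl. Qed.

Lemma vle_scale x d t : orthant x -> d <= t -> vle (d *: x) (t *: x).
Proof. by move=> x0 dt i; rewrite !mxE ler_wpM2r. Qed.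

Lemma near_coord p i (P : set R) : nbhs (p 0 i) P ->
  \forall y \near p, P ((y : vec) 0 i).
Proof. exact: (@coord_continuous _ _ _ 0 i p). Qed.

(** A multiplicative lower bound fits homogeneous functions; at a coordinate where [p] vanishes it
    only asks that [y] be nonnegative. *)
Lemma near_vle_scale p d : orthant p -> 0 < d ->
  \forall y \near p, orthant y -> vle ((1 - d) *: p) y.
Proof.
move=> p0 d0; near=> y => y0 i; rewrite mxE.
have [pi0|pi0] := ltP 0 (p 0 i); last first.
  have -> : p 0 i = 0 by [apply/eqP; rewrite eq_le pi0 p0].
  by rewrite mulr0.
move: i pi0; near: y; apply: filter_forall => i.
have [pi0|pi0] := ltP 0 (p 0 i); last by apply: nearW.
have : \forall z \near (p 0 i), (1 - d) * p 0 i < z.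
  by apply: lt_nbhsr; rewrite gtr_pMl // gtrBl.
move=> /near_coord H.
by apply: filterS H => y H _; exact: ltW.
Unshelve. all: by end_near. Qed.

Lemma near_vle_shift p d : 0 < d -> \forall y \near p, vle y (p + const_mx d).
Proof.
move=> d0; near=> y => i; move: i; near: y; apply: filter_forall => i.
have : \forall z \near (p 0 i), z < p 0 i + d by apply: lt_nbhsl; rewrite ltrDl.
by move=> /near_coord H; apply: filterS H => y H; rewrite !mxE ltW.
Unshelve. all: by end_near. Qed.

Lemma near_shift_vle p d : 0 < d -> \forall y \near p, vle p (y + const_mx d).
Proof.
move=> d0; near=> y => i; move: i; near: y; apply: filter_forall => i.
have : \forall z \near (p 0 i), p 0 i - d < z by apply: lt_nbhsr; rewrite gtrBl.
move=> /near_coord H; apply: filterS H => y H; rewrite !mxE.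
by rewrite -lerBlDr ltW.
Unshelve. all: by end_near. Qed.

Lemma orthant_closed : closed (orthant : set vec).
Proof.
move=> p clp i; rewrite leNgt; apply/negP => pi0.
have d0 : 0 < - p 0 i / 2 by rewrite divr_gt0 // oppr_gt0.
have [y [y0 /(_ i)]] := clp _ (near_vle_shift p d0).
by rewrite !mxE; have := y0 i; lra.
Qed.

Definition box x : set vec := [set y | orthant y /\ vle y x].

Lemma box_compact x : compact (box x).
Proof.
have := @rV_compact _ _ (fun i => `[0, x 0 i]%classic)
  (fun i => @segment_compact _ _ _).
congr compact; apply/seteqP; split => y /= yx.
  split => i; have := yx i; rewrite /= in_itv /= => /andP[? ?] //.
by move=> i; case: yx => y0 yx; rewrite /= in_itv /= y0 yx.
Qed.

Lemma box_comprehensive x : comprehensive (box x).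
Proof. by move=> y z _ z0 [_ yx] zy; split => //; apply: vle_trans yx. Qed.

Lemma box_corner x : orthant x -> box x x.
Proof. by move=> x0; split => //; apply: vle_refl. Qed.

Lemma problem_box x : (0 < n)%N -> (forall i, 0 < x 0 i) -> problem (box x).
Proof.
move=> n0 x0; have Xx : box x x by apply: box_corner => i; exact: ltW.
split=> //; [by exists x|by move=> y []|exact: box_compact|
  exact: box_comprehensive|by move=> i; exists x].
Qed.

Lemma problem_setU S A : problem S -> A `<=` orthant -> compact A ->
  comprehensive A -> problem (S `|` A).
Proof.
move=> [[s Ss] So Sk Sc Sp] Ao Ak Ac; split.
- by exists s; left.
- by move=> x [/So|/Ao].
- exact: compactU.
- by move=> x y x0 y0 [Sx|Ax] yx; [left; apply: Sc yx|right; apply: Ac yx].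
- by move=> i; have [x Sx xi] := Sp i; exists x => //; left.
Qed.

Lemma problem_setU_box S x : problem S -> problem (S `|` box x).
Proof.
move=> pS; apply: problem_setU => //; [by move=> y []|exact: box_compact|].
exact: box_comprehensive.
Qed.

Lemma undominated_box S x z : S z -> vle x z ->
  ~ (exists2 y, S y & vlt x y) -> x = z.
Proof.
by move=> Sz xz H; apply: contrapT => xNz; apply: H; exists z.
Qed.

End Orthant.

(** * Homogeneous welfare functions *)

Section Welfare.
Context {R : realType} {n : nat}.
Local Notation vec := 'rV[R]_n.
Implicit Types (x y z p : vec) (S A : set vec) (d t : R).

Record welfare (u : vec -> R) : Prop := Welfare {
  welfare_ge0 : forall x, orthant x -> 0 <= u x;
  welfare_mono : forall x y, orthant x -> vle x y -> u x <= u y;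
  welfareZ : forall x d, orthant x -> 0 < d -> u (d *: x) = d * u x;
  welfare_perm : forall x (pi : 'S_n), orthant x -> u (col_perm pi x) = u x;
  welfare_ones : u (const_mx 1) = 1 }.

Variable u : vec -> R.
Hypotheses (n0 : (0 < n)%N) (wu : welfare u).

Lemma welfare_const d : 0 < d -> u (const_mx d) = d.
Proof.
move=> d0; have -> : const_mx d = d *: const_mx 1 :> vec.
  by apply/rowP => i; rewrite !mxE mulr1.
by rewrite (welfareZ wu) ?(welfare_ones wu) ?mulr1 //; apply: orthant_const.
Qed.

Lemma welfare_argmaxP S x :
  argmax S (fun x => (u x)%:E) x <-> S x /\ forall y, S y -> u y <= u x.
Proof.
by split=> -[Sx mx]; split=> // y /mx; rewrite lee_fin.
Qed.

Hypothesis max_u : forall S, problem S -> argmax S (fun x => (u x)%:E) !=set0.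

(* If [u (x + e)] stays above some [L > u x] for all [e > 0], then the set [T]
   below is a problem (it is closed because [u] is lower semicontinuous) on which
   [u < L] has supremum [L], so that [u] has no maximum on [T]. *)
Lemma welfare_usc x d : orthant x -> 0 < d ->
  exists2 e, 0 < e & u (x + const_mx e) < u x + d.
Proof.
move=> x0 d0; apply: contrapT => noe.
pose L := u x + d.
have ux0 := welfare_ge0 wu x0.
have L0 : 0 < L by rewrite /L; lra.
have uL e : 0 < e -> L <= u (x + const_mx e).
  by move=> e0; rewrite leNgt; apply/negP => ue; apply: noe; exists e.
(* The bound decreases in each [y 0 i], which makes [T] comprehensive. It caps [y 0 i] at
   [x 0 i + 1] because [u y] is nonnegative, and it falls below [L] as soon as [y] exceeds [x] in
   some coordinate. *)
pose T := [set y : vec | orthant y /\ forall i, u y <= L * (1 + x 0 i - y 0 i)].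
(* The vector [x + e] is shrunk to welfare exactly [L * (1 - e)]. The factor is at most 1, so each
   coordinate stays below [x 0 i + e] and the constraints of [T] hold. *)
pose z e := (L * (1 - e) / u (x + const_mx e)) *: (x + const_mx e).
have xe0 e : 0 < e -> orthant (x + const_mx e).
  by move=> e0; apply: orthant_vle x0 _; apply: vle_shift; exact: ltW.
have uz e : 0 < e < 1 -> u (z e) = L * (1 - e).
  move=> /andP[e0 e1]; have ue := uL _ e0.
  have ue0 : 0 < u (x + const_mx e) by lra.
  rewrite (welfareZ wu) ?divfK ?gt_eqF //; first exact: xe0.
  by rewrite divr_gt0 // mulr_gt0 // subr_gt0.
have Tz e : 0 < e < 1 -> T (z e).
  move=> e01; have /andP[e0 e1] := e01; have ue := uL _ e0.
  have ue0 : 0 < u (x + const_mx e) by lra.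
  have c0 : 0 <= L * (1 - e) / u (x + const_mx e).
    by rewrite divr_ge0 ?mulr_ge0 //; lra.
  have c1 : L * (1 - e) / u (x + const_mx e) <= 1.
    by rewrite ler_pdivrMr // mul1r; nra.
  split; first by apply: orthantZ => //; exact: xe0.
  move=> i; rewrite uz // ler_pM2l //.
  have /= := vle_scale (xe0 _ e0) c1 i; rewrite -/(z e) scale1r !mxE; lra.
have uT y : T y -> u y < L.
  move=> [y0 Ty]; have [yx|/existsNP[i /negP]] := pselect (vle y x).
    by apply: le_lt_trans (welfare_mono wu y0 yx) _; rewrite /L ltrDl.
  by rewrite -ltNge => xy; apply: le_lt_trans (Ty i) _; nra.
have half01 : 0 < (1 / 2 : R) < 1 by lra.
have pT : problem T.
  split.
  - by exists (z (1 / 2)); exact: Tz.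
  - by move=> y [].
  - apply: (@subclosed_compact _ T (box (x + const_mx 1)));
      [|exact: box_compact|]; last first.
      move=> y [y0 Ty]; split => // i; have := Ty i.
      by have := welfare_ge0 wu y0; rewrite !mxE; nra.
    move=> p clp; have p0 : orthant p.
      by apply: orthant_closed => B /clp [y [[y0 _] By]]; exists y.
    split => // i; apply/ler_addgt0Pr => e e0.
    have up0 := welfare_ge0 wu p0.
    (* For [y] in [T] with [(1 - k) p <= y] and [p <= y + k], the constraint at [p] fails by at most
       [k * (u p + L)]: scaling costs [k * u p] and the shift costs [k * L]. *)
    pose c := u p + L + 1.
    have c0 : 0 < c by rewrite /c; lra.
    pose k := Num.min (1/2) (e / c).
    have k0 : 0 < k by rewrite lt_min !divr_gt0.
    have kc : k * c <= e by rewrite -ler_pdivlMr // ge_min lexx orbT.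
    have k1 : k <= 1 / 2 by rewrite ge_min lexx.
    have [y [[y0 Ty] [py1 py2]]] := clp _
      (filterI (near_vle_scale p0 k0) (near_shift_vle p k0)).
    have := welfare_mono wu (orthantZ p0 _) (py1 y0).
    rewrite (welfareZ wu) //; last lra.
    move=> /(_ ltac:(lra)); have := Ty i; have := py2 i; rewrite !mxE.
    rewrite /c in kc; nra.
  - move=> y y' y0 y'0 [_ Ty] y'y; split => // i.
    apply: le_trans (welfare_mono wu y'0 y'y) _.
    by apply: le_trans (Ty i) _; rewrite ler_pM2l // lerB.
  - move=> i; exists (z (1 / 2)); first exact: Tz.
    have h0 : 0 < (1 / 2 : R) by lra.
    have := uL _ h0; rewrite !mxE => uh.
    rewrite mulr_gt0 ?divr_gt0 ?mulr_gt0 //; try lra.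
    by have := x0 i; lra.
have [y /welfare_argmaxP [Ty My]] := max_u pT.
have uyL := uT _ Ty; have uy0 := welfare_ge0 wu (Ty.1).
(* This puts [L * (1 - e)] midway between [u y] and [L], so that [z e] beats the supposed maximizer
   [y]. *)
pose e := (1 - u y / L) / 2.
have r1 : u y / L < 1 by rewrite ltr_pdivrMr // mul1r.
have r0 : 0 <= u y / L by rewrite divr_ge0 // ltW.
have e01 : 0 < e < 1 by rewrite /e; lra.
have := My _ (Tz _ e01); rewrite uz //.
have : u y = (u y / L) * L by rewrite divfK // gt_eqF.
by rewrite /e; nra.
Qed.

End Welfare.

(** * Convergence in the Hausdorff distance *)

Section Hausdorff.
Context {R : realType} {n : nat}.
Local Notation vec := 'rV[R]_n.
Implicit Types (x y z p : vec) (S A : set vec) (d t : R).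

(** The half of the distance that measures [S] from [S_ k] makes every point of the limit a limit of
    points of the [S_ k]. *)
Lemma hausdorff_dist_near (S_ : nat -> set vec) S y (B : set vec) :
  hausdorff_dist (S_ k) S @[k --> \oo] --> 0%E -> S y -> nbhs y B ->
  \forall k \near \oo, exists2 y', S_ k y' & B y'.
Proof.
move=> cvS Sy /nbhs_ballP[r /= r0 rB].
have : \forall k \near \oo, (hausdorff_dist (S_ k) S < r%:E)%E.
  exact: (cvS _ (@open_ereal_lt' R 0%E r%:E ltac:(by rewrite lte_fin))).
apply: filterS => k; rewrite /hausdorff_dist gt_max => /andP[_ Hk].
have : (edist_inf (S_ k) y < r%:E)%E.
  by apply: le_lt_trans Hk; apply: ereal_sup_ubound; exists y.
by move=> /ereal_inf_lt[_ [y' Sy' <-] /edist_lt_ball /rB]; exists y'.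
Qed.

(** As [S] is included in each [S_ k], one of the two suprema is 0 and the other is at most
    [e k]. *)
Lemma hausdorff_dist_cvg0 (S_ : nat -> set vec) S (e : nat -> R) :
  S !=set0 -> (forall k, S `<=` S_ k) -> (forall k, 0 < e k) ->
  e k @[k --> \oo] --> 0 ->
  (forall k a, S_ k a -> exists2 s, S s & forall i, `|a 0 i - s 0 i| < e k) ->
  hausdorff_dist (S_ k) S @[k --> \oo] --> 0%E.
Proof.
move=> [s0 Ss0] SS e0 ecvg Snear.
apply: (@squeeze_cvge _ _ _ _ (fun=> 0%E) _ (fun k => (e k)%:E)); last 2 first.
- exact: cvg_cst.
- by apply: cvg_EFin => //; apply: nearW.
apply: nearW => k; apply/andP; split.
  rewrite le_max; apply/orP; right.
  by apply: le_trans (ereal_sup_ubound _); [|exists s0 => //]; exact: edist_inf_ge0.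
rewrite ge_max; apply/andP; split; apply: ge_ereal_sup => _ [a aS <-].
  have [s Ss as_] := Snear k a aS.
  apply: le_trans (_ : edist (a, s) <= _)%E.
    by apply: ereal_inf_lbound; exists s.
  by apply: edist_fin => //; split => // i j; rewrite [i]ord1; exact: as_.
by rewrite edist_inf0 ?lee_fin ?ltW //; exact: SS.
Qed.

End Hausdorff.

(** * Maximizing a welfare function satisfies the axioms *)

Section Argmax.
Context {R : realType} {n : nat}.
Local Notation vec := 'rV[R]_n.
Implicit Types (x y z p : vec) (S A : set vec) (d t : R).

Lemma problemZ S d : problem S -> 0 < d -> problem [set d *: x | x in S].
Proof.
move=> [[s Ss] So Sk Sc Sp] d0; split.
- by exists (d *: s), s.
- by move=> _ [x /So x0 <-]; apply: orthantZ x0 _; exact: ltW.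
- apply: continuous_compact Sk; apply: continuous_subspaceT.
  exact: scaler_continuous.
- move=> x' y x'0 y0 [x Sx xx'] yx; rewrite -xx' in yx; exists (d^-1 *: y); last first.
    by rewrite scalerA divff ?gt_eqF // scale1r.
  apply: Sc (Sx) _; first exact: So.
    by apply: orthantZ y0 _; rewrite invr_ge0 ltW.
  by move=> i; have := yx i; rewrite !mxE ler_pdivrMl.
- by move=> i; have [x Sx xi] := Sp i; exists (d *: x); [exists x|rewrite mxE mulr_gt0].
Qed.

Variables (F : set vec -> set vec) (u : vec -> R).
Hypotheses (n0 : (0 < n)%N) (wu : welfare u) (hF : solution F).
Hypothesis FE : forall S, problem S -> F S = argmax S (fun x => (u x)%:E).

Lemma FP S x : problem S -> F S x <-> S x /\ forall y, S y -> u y <= u x.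
Proof. by move=> pS; rewrite FE //; exact: welfare_argmaxP. Qed.

(** The maximizers that [welfare_usc] asks for exist because [F S] is nonempty. *)
Let u_usc x d : orthant x -> 0 < d ->
  exists2 e, 0 < e & u (x + const_mx e) < u x + d.
Proof.
apply: welfare_usc => // S pS; rewrite -FE //.
by case: (hF pS).
Qed.

Let superlevel_closed d : closed [set x | orthant x /\ d <= u x].
Proof.
move=> p clp; have p0 : orthant p.
  by apply: orthant_closed => B /clp [y [[y0 _] By]]; exists y.
split => //; rewrite leNgt; apply/negP => up.
have [e e0] := u_usc p0 (ltac:(by rewrite subr_gt0) : 0 < d - u p).
rewrite subrKC => ue.
have [y [[y0 uy] yp]] := clp _ (near_vle_shift p e0).
by have := welfare_mono wu y0 yp; lra.
Qed.

Lemma argmax_pareto : intermediate_pareto F.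
Proof.
move=> S pS; have [_ So Sk Sc Sp] := pS; split.
  move=> x /(FP _ pS) [Sx mx] [y Sy xy].
  have x0 := So _ Sx; have uyx := mx _ Sy.
  (* This gives both [(1 + e) x <= y] and [(e, ..., e) <= y]. The first yields [u y > u x] when
     [u x > 0], the second when [u x = 0]. *)
  have [e e0 exy] : exists2 e, 0 < e & forall i, e * (1 + x 0 i) <= y 0 i - x 0 i.
    have : \forall e \near 0^'+, forall i, e * (1 + x 0 i) <= y 0 i - x 0 i.
      near=> e => i; move: i; near: e; apply: filter_forall => i.
      have xi : 0 < 1 + x 0 i by have := x0 i; lra.
      near=> e; rewrite -ler_pdivlMr //; near: e.
      by apply: nbhs_right_le; rewrite divr_gt0 // subr_gt0.
    move=> H; have [e [He e0]] := filter_ex (filterI H (nbhs_right_gt 0)).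
    by exists e.
  have ux0 := welfare_ge0 wu x0.
  have e1 : vle (const_mx e) y.
    by move=> i; rewrite mxE; have := exy i; have := x0 i; nra.
  have ex : vle ((1 + e) *: x) y.
    by move=> i; rewrite mxE; have := exy i; have := x0 i; nra.
  have := welfare_mono wu (orthant_const (ltW e0)) e1.
  rewrite welfare_const // => uy.
  have := welfare_mono wu (orthantZ x0 (ltac:(lra) : 0 <= 1 + e)) ex.
  by rewrite (welfareZ wu) //; [nra|lra].
have [x1 /(FP _ pS) [Sx1 mx1]] := (hF pS).1.
(* [T] is the set of maximizers of [u] on [S], compact by upper semicontinuity; a point of [T] with
   the largest coordinate sum is undominated. *)
pose T := S `&` [set x | orthant x /\ u x1 <= u x].
have [|||z /set_mem [Sz [_ uz]] mz] := @EVT_max_rV R n (fun x => \sum_i x 0 i) T.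
- by exists x1; split => //; split => //; exact: So.
- by apply: compact_closedI => //; exact: superlevel_closed.
- apply: continuous_subspaceT; apply: continuous_big; first exact: add_continuous.
  by move=> i _; exact: coord_continuous.
have mzS y : S y -> u y <= u z by move=> /mx1 /le_trans; apply.
exists z; first by apply/(FP _ pS).
move=> [y Sy [zy yz]]; apply: yz; apply/rowP => i; apply/esym/eqP.
have uy : u x1 <= u y by apply: le_trans uz _; apply: welfare_mono => //; exact: So.
have := mz y; rewrite inE => /(_ (conj Sy (conj (So _ Sy) uy))).
(* Equality of the sums of two ordered vectors forces equality of the vectors. *)
have [le_zy eq_zy] : \sum_j z 0 j <= \sum_j y 0 j
    ?= iff [forall j, z 0 j == y 0 j].
  by apply: leif_sum => j _; split.
move=> le_yz; move: eq_zy; rewrite eq_le le_zy le_yz.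
by move=> /= /esym/forallP /(_ i); rewrite eq_sym.
Unshelve. all: by end_near. Qed.

Lemma argmax_homogeneity : homogeneity F.
Proof.
move=> S d pS d0; have pdS := problemZ pS d0; have [_ So _ _ _] := pS.
apply/seteqP; split => x.
  move=> /(FP _ pdS) [[y Sy <-] my]; exists y => //; apply/(FP _ pS); split => // z Sz.
  have := my (d *: z); rewrite !(welfareZ wu) ?ler_pM2l //; try exact: So.
  by apply; exists z.
move=> [y /(FP _ pS) [Sy my] <-]; apply/(FP _ pdS); split; first by exists y.
move=> _ [z Sz <-]; rewrite !(welfareZ wu) ?ler_pM2l //; try exact: So.
exact: my.
Qed.

Lemma argmax_anonymity : anonymity F.
Proof.
move=> S pS sS x /(FP _ pS) [Sx mx] pi; apply/(FP _ pS).
have [_ So _ _ _] := pS; split; first by rewrite (sS pi); exists x.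
by move=> y /mx; rewrite (welfare_perm wu) //; exact: So.
Qed.

(** For [y] in [S], some [y'] in [S_ k] lies above [(1 - d) y], while [x_ k] lies below [x + r].
    Hence [(1 - d) u y <= u y' <= u (x_ k) <= u (x + r) < u x + e / 2], and [d] is chosen with
    [d * u y <= e / 2]. *)
Lemma argmax_continuity : continuity F.
Proof.
move=> S x pS Sx [S_ [x_ [pS_ Fx_ cvS cvx]]]; apply/(FP _ pS); split => // y Sy.
have [_ So _ _ _] := pS.
have x0 := So _ Sx; have y0 := So _ Sy.
have uy0 := welfare_ge0 wu y0.
apply/ler_addgt0Pr => e e0.
pose c := u y + 1.
have c0 : 0 < c by rewrite /c; lra.
pose d := Num.min (1 / 2) (e / 2 / c).
have d0 : 0 < d by rewrite lt_min !divr_gt0.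
have dc : d * c <= e / 2 by rewrite -ler_pdivlMr // ge_min lexx orbT.
have d1 : d <= 1 / 2 by rewrite ge_min lexx.
have [r r0 ur] := u_usc x0 (divr_gt0 e0 (ltr0Sn _ 1)).
have xnear : \forall k \near \oo, vle (x_ k) (x + const_mx r).
  exact: cvx (near_vle_shift x r0).
have [k [xk [y' Sy' yy']]] := filter_ex (filterI xnear
  (hausdorff_dist_near cvS Sy (near_vle_scale y0 d0))).
have [/= Sxk mk] := (FP _ (pS_ k)).1 (Fx_ k).
have [_ Sok _ _ _] := pS_ k.
have := welfare_mono wu (Sok _ Sxk) xk.
have := welfare_mono wu (orthantZ y0 _) (yy' (Sok _ Sy')).
rewrite (welfareZ wu) //; last lra.
move=> /(_ ltac:(lra)); have := mk _ Sy'.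
rewrite /c in dc; nra.
Qed.

Lemma argmax_iia : iia F.
Proof.
move=> S S' pS pS' S'S [x [S'x /(FP _ pS) [Sx mx]]]; apply/seteqP; split => y.
  move=> /(FP _ pS') [S'y my]; split => //; apply/(FP _ pS); split; first exact: S'S.
  by move=> z /mx /le_trans; apply; exact: my.
move=> [S'y /(FP _ pS) [Sy my]]; apply/(FP _ pS'); split => // z /S'S; exact: my.
Qed.

End Argmax.
(** * Max-min of weighted products *)

Section WeightedProduct.
Context {R : realType} {n : nat}.
Local Notation vec := 'rV[R]_n.
Implicit Types (x y w : vec) (c : vec -> \bar R) (C : set (vec -> \bar R)).

Definition cobb_douglas x w : R := \prod_i x 0 i `^ w 0 i.

Lemma cobb_douglas_ge0 x w : 0 <= cobb_douglas x w.
Proof. by apply: prodr_ge0 => i _; exact: powR_ge0. Qed.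

Lemma cobb_douglas_mono x y w : orthant x -> orthant w -> vle x y ->
  cobb_douglas x w <= cobb_douglas y w.
Proof.
move=> x0 w0 xy; apply: ler_prod => i _; rewrite powR_ge0 /=.
have y0 := orthant_vle x0 xy.
by apply: ge0_ler_powR => //; rewrite nnegrE.
Qed.

Lemma prod_powR (d : R) w : d != 0 ->
  \prod_i d `^ w 0 i = d `^ (\sum_i w 0 i).
Proof.
move=> d0; apply/esym; apply: (big_morph (powR d)) => [a b|].
  by rewrite powRD // d0 implybT.
exact: powRr0.
Qed.

Lemma cobb_douglasZ x (d : R) w : orthant x -> 0 < d -> simplex w ->
  cobb_douglas (d *: x) w = d * cobb_douglas x w.
Proof.
move=> x0 d0 [_ w1]; transitivity (\prod_i (d `^ w 0 i * x 0 i `^ w 0 i)).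
  by apply: eq_bigr => i _; rewrite mxE powRM // ltW.
by rewrite big_split /= prod_powR ?gt_eqF // w1 powRr1 // ltW.
Qed.

Lemma cobb_douglas_ones w : cobb_douglas (const_mx 1) w = 1.
Proof. by rewrite /cobb_douglas big1 // => i _; rewrite mxE powR1. Qed.

Lemma cobb_douglas_perm x w (pi : 'S_n) :
  cobb_douglas (col_perm pi x) (col_perm pi w) = cobb_douglas x w.
Proof.
rewrite /cobb_douglas [RHS](reindex_inj (@perm_inj _ pi)).
by apply: eq_bigr => i _; rewrite !mxE.
Qed.

Lemma simplex_perm w (pi : 'S_n) : simplex w -> simplex (col_perm pi w).
Proof.
move=> [w0 w1]; split; first exact: orthant_perm.
rewrite -[RHS]w1 [RHS](reindex_inj (@perm_inj _ pi)).
by apply: eq_bigr => i _; rewrite mxE.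
Qed.

Lemma col_permKV (pi : 'S_n) w : col_perm pi (col_perm pi^-1%g w) = w.
Proof. by apply/rowP => i; rewrite !mxE permK. Qed.

Lemma col_permVK (pi : 'S_n) w : col_perm pi^-1%g (col_perm pi w) = w.
Proof. by apply/rowP => i; rewrite !mxE permKV. Qed.

(** Weights are matched forwards and points of the simplex backwards. Letting both be reindexed
    serves monotonicity, normalization and symmetry alike. *)
Lemma le_maxmin C (V V' : (vec -> \bar R) -> vec -> \bar R) :
  (forall c, C c -> exists2 c', C c' & forall w, simplex w ->
    exists2 w', simplex w' & (V c w' <= V' c' w)%E) ->
  (maxmin C V <= maxmin C V')%E.
Proof.
move=> VV'; apply: ge_ereal_sup => _ [c /VV' [c' Cc' VVc] <-].
apply: le_trans (ereal_sup_ubound _); last by exists c'.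
apply: le_ereal_inf_tmp => _ [w /VVc [w' sw' Vw'] <-].
by apply: le_trans Vw'; apply: ereal_inf_lbound; exists w'.
Qed.

Lemma le_weighted_product x y c w : orthant x -> vle x y -> simplex w ->
  (0 < c w)%E -> (weighted_product x c w <= weighted_product y c w)%E.
Proof.
move=> x0 xy [w0 _] cw; rewrite /weighted_product; case: eqP => // _.
apply: lee_wpmul2l; first exact: ltW.
by rewrite lee_fin; exact: cobb_douglas_mono.
Qed.

Lemma weighted_product_ge0 x c w : (0 < c w)%E -> (0 <= weighted_product x c w)%E.
Proof.
move=> cw; rewrite /weighted_product; case: eqP => // _.
by apply: mule_ge0; [exact: ltW|rewrite lee_fin cobb_douglas_ge0].
Qed.

Lemma weighted_productZ x (d : R) c w : orthant x -> 0 < d -> simplex w ->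
  weighted_product (d *: x) c w = (d%:E * weighted_product x c w)%E.
Proof.
move=> x0 d0 sw; rewrite /weighted_product; case: eqP => _.
  by rewrite gt0_muley.
by rewrite -!/(cobb_douglas _ _) cobb_douglasZ // EFinM muleCA.
Qed.

Lemma weighted_product_ones c w : weighted_product (const_mx 1) c w = c w.
Proof.
rewrite /weighted_product -/(cobb_douglas _ _) cobb_douglas_ones mule1.
by case: eqP.
Qed.

Lemma weighted_product_perm x c c' w (pi : 'S_n) : c' w = c (col_perm pi w) ->
  weighted_product (col_perm pi x) c (col_perm pi w) = weighted_product x c' w.
Proof.
by move=> cc'; rewrite /weighted_product cc' -!/(cobb_douglas _ _)
  cobb_douglas_perm.
Qed.

End WeightedProduct.

Lemma eq_argmax {R : realType} {n : nat} (S : set 'rV[R]_n)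
  (U V : 'rV[R]_n -> \bar R) : (forall x, S x -> U x = V x) ->
  argmax S U = argmax S V.
Proof.
move=> UV; apply/seteqP; split => x [Sx mx]; split => // y Sy.
  by rewrite -!UV //; exact: mx.
by rewrite !UV //; exact: mx.
Qed.

(** * The max-min value as a welfare function *)

Section MaxminWelfare.
Context {R : realType} {n : nat}.
Local Notation vec := 'rV[R]_n.
Implicit Types (x y w : vec) (c : vec -> \bar R).
Variable C : set (vec -> \bar R).
Hypotheses (C0 : C !=set0) (symC : symmetric_collection C)
  (posC : forall c, C c -> positive_weight c)
  (C1 : maxmin C (fun c w => c w) = 1%E).

Let U x := maxmin C (weighted_product x).

Let U_mono x y : orthant x -> vle x y -> (U x <= U y)%E.
Proof.
move=> x0 xy; apply: le_maxmin => c Cc; exists c => // w sw; exists w => //.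
by apply: le_weighted_product => //; exact: posC.
Qed.

Let U_ones : U (const_mx 1) = 1%E.
Proof.
rewrite -C1; apply/eqP; rewrite eq_le; apply/andP; split;
  apply: le_maxmin => c Cc; exists c => // w sw; exists w => //;
  by rewrite weighted_product_ones.
Qed.

Let U_ge0 x : (0 <= U x)%E.
Proof.
have [c Cc] := C0; apply: le_trans (ereal_sup_ubound _); last by exists c.
by apply: le_ereal_inf_tmp => _ [w sw <-]; apply: weighted_product_ge0; exact: posC.
Qed.

Let leUZ x (d : R) : orthant x -> 0 < d -> (U (d *: x) <= d%:E * U x)%E.
Proof.
move=> x0 d0; apply: ge_ereal_sup => _ [c Cc <-].
apply: (@le_trans _ _ (d%:E * min_simplex (weighted_product x) c)%E); last first.
  by rewrite lee_pmul2l ?lte_fin //; apply: ereal_sup_ubound; exists c.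
rewrite -lee_pdivrMl //; apply: le_ereal_inf_tmp => _ [w sw <-].
rewrite lee_pdivrMl // -weighted_productZ //.
by apply: ereal_inf_lbound; exists w.
Qed.

(** The missing inequality is [leUZ] at [d *: x] with the factor [d^-1]. *)
Let UZ x (d : R) : orthant x -> 0 < d -> U (d *: x) = (d%:E * U x)%E.
Proof.
move=> x0 d0; apply/eqP; rewrite eq_le leUZ //=.
have dV0 : 0 < d^-1 by rewrite invr_gt0.
have xE : d^-1 *: (d *: x) = x by rewrite scalerA mulVf ?gt_eqF // scale1r.
have := leUZ (orthantZ x0 (ltW d0)) dV0.
by rewrite xE lee_pdivlMl.

Qed.

Let le_U_perm x (pi : 'S_n) : (U (col_perm pi x) <= U x)%E.
Proof.
apply: le_maxmin => c /(symC pi) [c' Cc' cc']; exists c' => // w sw.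
exists (col_perm pi w); first exact: simplex_perm.
by rewrite (weighted_product_perm _ (cc' w sw)).
Qed.

Let U_perm x (pi : 'S_n) : U (col_perm pi x) = U x.
Proof.
apply: le_anti; apply/andP; split; first exact: le_U_perm.
by have := le_U_perm (col_perm pi x) pi^-1%g; rewrite col_permVK.
Qed.

(** A large constant vector [(M, ..., M)] dominates [x], and its value is [M] by homogeneity and
    normalization. *)
Lemma maxmin_fin x : orthant x -> maxmin C (weighted_product x) \is a fin_num.
Proof.
move=> x0; rewrite ge0_fin_numE ?U_ge0 //.
pose M := 1 + \sum_i x 0 i.
have sum0 : 0 <= \sum_i x 0 i by apply: sumr_ge0.
have M0 : 0 < M by rewrite /M; lra.
have xM : vle x (M *: const_mx 1).
  move=> i; rewrite !mxE mulr1 /M (bigD1 i) //=.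
  have : 0 <= \sum_(j | j != i) x 0 j by apply: sumr_ge0.
  by lra.
apply: le_lt_trans (U_mono x0 xM) _.
by rewrite UZ // ?U_ones ?mule1 ?ltry //; apply: orthant_const.
Qed.

Lemma maxmin_welfare : welfare (fun x => fine (maxmin C (weighted_product x))).
Proof.
split.
- by move=> x x0; apply: fine_ge0; exact: U_ge0.
- move=> x y x0 xy; have y0 := orthant_vle x0 xy.
  by apply: fine_le (U_mono x0 xy); exact: maxmin_fin.
- move=> x d x0 d0; rewrite -/(U _) UZ // fineM //; exact: maxmin_fin.
- by move=> x pi x0; rewrite -!/(U _) U_perm.
- by rewrite -/(U _) U_ones.
Qed.

Lemma argmax_maxmin_fine (S : set vec) : problem S ->
  argmax S (fun x => maxmin C (weighted_product x)) =
  argmax S (fun x => (fine (maxmin C (weighted_product x)))%:E).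
Proof.
move=> [_ So _ _ _]; apply: eq_argmax => x Sx.
by apply/esym/fineK/maxmin_fin; exact: So.
Qed.

End MaxminWelfare.
(** * Leontief weights *)

Section Representation.
Context {R : realType} {n : nat}.
Local Notation vec := 'rV[R]_n.
Implicit Types (x y w : vec) (c : vec -> \bar R).
Variable u : vec -> R.
Hypotheses (n0 : (0 < n)%N) (wu : welfare u).

(* With [1 / 0] read as [+oo], this is [u x / prod_i x_i^(w_i)]. *)
Definition leontief_weight x w : \bar R :=
  if cobb_douglas x w == 0 then +oo%E else (u x / cobb_douglas x w)%:E.

(** Points with [u x = 0] are left out, since their weight would take the value 0 instead of
    positive values. *)
Definition leontief_weights : set (vec -> \bar R) :=
  [set leontief_weight x | x in [set x | orthant x /\ 0 < u x]].

Lemma cobb_douglas_eq0 x w : cobb_douglas x w = 0 <->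
  exists2 i, x 0 i = 0 & w 0 i != 0.
Proof.
rewrite /cobb_douglas; split => [/eqP|[i xi wi]].
  by rewrite prodf_seq_eq0 => /hasP [i _ /=]; rewrite powR_eq0 => /andP[/eqP]; exists i.
by rewrite (bigD1 i) //= xi powR0 // mul0r.
Qed.

(** Otherwise [x = 0 = 2 x], and homogeneity gives [u x = 2 u x]. *)
Lemma welfare_gt0_coord x : orthant x -> 0 < u x -> exists i, 0 < x 0 i.
Proof.
move=> x0 ux; apply: contrapT => noi.
have xE : x = 2 *: x.
  apply/rowP => i; rewrite mxE.
  have -> : x 0 i = 0; last by rewrite mulr0.
  apply/eqP; rewrite eq_le x0 andbT leNgt; apply/negP => xi.
  by apply: noi; exists i.
by have := welfareZ wu x0 (ltr0Sn R 1); rewrite -xE; lra.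
Qed.

Lemma simplex_delta (i : 'I_n) : simplex (delta_mx 0 i : vec).
Proof.
split=> [j|]; first by rewrite mxE; exact: ler0n.
rewrite (bigD1 i) //= mxE !eqxx big1 ?addr0 // => j ji.
by rewrite mxE (negPf ji) andbF.
Qed.

Lemma cobb_douglas_delta x i : 0 <= x 0 i -> cobb_douglas x (delta_mx 0 i) = x 0 i.
Proof.
move=> xi; rewrite /cobb_douglas (bigD1 i) //= mxE !eqxx powRr1 // big1 ?mulr1 // => j ji.
by rewrite mxE (negPf ji) andbF powRr0.
Qed.

(** Here [r] is the minimum of [y_i / x_i] over [x_i > 0], the largest factor with [r x <= y]. The
    vertex of the simplex at a minimizing [i] attains the value [r * u x]; at any other [w] the
    product at [y] is at least that at [r x]. *)
Lemma leontief_weightP x y : orthant x -> 0 < u x -> orthant y ->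
  exists r, [/\ 0 <= r, r * u x <= u y, x = y -> r = 1,
    exists2 w, simplex w & weighted_product y (leontief_weight x) w = (r * u x)%:E &
    forall w, simplex w ->
      ((r * u x)%:E <= weighted_product y (leontief_weight x) w)%E].
Proof.
move=> x0 ux y0; have [i0 xi0] := welfare_gt0_coord x0 ux.
case: (@arg_minP _ _ _ i0 (fun i => 0 < x 0 i) (fun i => y 0 i / x 0 i) xi0).
move=> i xi mini; pose r := y 0 i / x 0 i.
have r0 : 0 <= r by rewrite divr_ge0 // ltW.
have rxy : vle (r *: x) y.
  move=> j; rewrite mxE; have [xj|xj] := ltP 0 (x 0 j).
    by rewrite -ler_pdivlMr //; exact: mini.
  have -> : x 0 j = 0 by [apply/eqP; rewrite eq_le xj x0].
  by rewrite mulr0.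
exists r; split => //.
(* The case [r = 0] is apart because homogeneity concerns positive factors only. *)
- move: r0; rewrite le_eqVlt => /orP[/eqP <-|r0].
    by rewrite mul0r; exact: (welfare_ge0 wu y0).
  rewrite -(welfareZ wu) //; apply: (welfare_mono wu) rxy;
    apply: orthantZ x0 _; exact: ltW.
- by move=> xy; rewrite /r -xy divff ?gt_eqF.
- exists (delta_mx 0 i); first exact: simplex_delta.
  rewrite /weighted_product /leontief_weight  -/(cobb_douglas _ _).
  rewrite (cobb_douglas_delta (ltW xi)) (cobb_douglas_delta (y0 i)).
  rewrite (gt_eqF xi) /= -EFinM.
  by rewrite /r mulrC mulrA mulrAC.
move=> w sw; rewrite /weighted_product /leontief_weight.
case: (eqVneq (cobb_douglas x w) 0) => [_|cx] /=; first by rewrite leey.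
have cx0 : 0 < cobb_douglas x w by rewrite lt_def cx cobb_douglas_ge0.
rewrite -/(cobb_douglas _ _) -EFinM lee_fin [leRHS]mulrAC ler_pdivlMr //.
rewrite [r * _]mulrC -mulrA ler_pM2l //.
move: (r0); rewrite le_eqVlt => /orP[/eqP <-|r0'].
  by rewrite mul0r; exact: cobb_douglas_ge0.
rewrite -cobb_douglasZ //; apply: cobb_douglas_mono => //; last by case: sw.
exact: orthantZ.
Qed.

Lemma leontief_weights_nonempty : leontief_weights !=set0.
Proof.
exists (leontief_weight (const_mx 1)), (const_mx 1) => //; split.
  exact: orthant_const.
by rewrite (welfare_ones wu).
Qed.

(** Permuting the argument of the weight of [x] by [pi] gives the weight of [x] permuted by the
    inverse of [pi]. *)
Lemma leontief_weights_symmetric : symmetric_collection leontief_weights.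
Proof.
move=> _ pi [x [x0 ux] <-]; have x'0 := orthant_perm pi^-1%g x0.
exists (leontief_weight (col_perm pi^-1%g x)).
  by exists (col_perm pi^-1%g x) => //; split => //; rewrite (welfare_perm wu).
move=> w sw; rewrite /leontief_weight (welfare_perm wu) //.
by rewrite -(cobb_douglas_perm _ w pi) col_permKV.
Qed.

Lemma leontief_weight_positive x : 0 < u x -> positive_weight (leontief_weight x).
Proof.
move=> ux w sw; rewrite /leontief_weight; case: eqVneq => [_|cx]; first exact: ltry.
by rewrite lte_fin divr_gt0 // lt_def cx cobb_douglas_ge0.
Qed.

(** A nonzero product forces [w 0 i = 0] wherever [x 0 i = 0], so the default value of [ln 0] is
    multiplied by 0. *)
Lemma cobb_douglas_expR x w : cobb_douglas x w != 0 ->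
  cobb_douglas x w = expR (\sum_i w 0 i * ln (x 0 i)).
Proof.
move=> cx; rewrite expR_sum; apply: eq_bigr => i _.
rewrite /powR; case: eqVneq => // xi.
have -> : w 0 i = 0 by apply: contra_neq_eq cx => wi; apply/cobb_douglas_eq0; exists i.
by rewrite mul0r expR0 eqxx.
Qed.

(** The domain is the face of the simplex where [w] vanishes on the zero coordinates of [x], and
    there the logarithm is the affine function [ln (u x) - sum_i w_i ln x_i]. *)
Lemma leontief_weight_log_convex x : 0 < u x -> log_convex (leontief_weight x).
Proof.
move=> ux.
have domP w : finite_dom (leontief_weight x) w <->
    simplex w /\ cobb_douglas x w != 0.
  rewrite /finite_dom /leontief_weight /=; case: eqVneq => _; last first.
    by split => -[sw _]; split => //; exact: ltry.
  by split => -[_].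
have convE (a b : vec) (t : {i01 R}) :
  (conv t (a : convex_lmodType vec) b : vec) =
  t%:num *: a + (1 - t%:num) *: b by [].
have convD : @convex_set R vec (finite_dom (leontief_weight x)).
  move=> a b t /set_mem/domP [[a0 a1] ca] /set_mem/domP [[b0 b1] cb].
  have t0 : 0 <= t%:num by exact: ge0.
  have t1 : 0 <= 1 - t%:num by rewrite subr_ge0; exact: le1.
  apply/mem_set/domP; rewrite convE; split; first split.
  - by move=> i; rewrite !mxE addr_ge0 ?mulr_ge0.
  - under eq_bigr do rewrite !mxE.
    by rewrite big_split /= -!big_distrr /= a1 b1 !mulr1 subrKC.
  apply/eqP => /cobb_douglas_eq0 [i xi]; rewrite !mxE.
  have wi0 w : cobb_douglas x w != 0 -> w 0 i = 0.
    by apply: contra_neq_eq => wi; apply/cobb_douglas_eq0; exists i.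
  by rewrite !wi0 // !mulr0 addr0 eqxx.
split => // t a b Da Db; have := convD a b t Da Db.
have lnE w : finite_dom (leontief_weight x) w ->
    ln (fine (leontief_weight x w)) = ln (u x) - \sum_i w 0 i * ln (x 0 i).
  move=> /domP [_ cw]; rewrite /leontief_weight (negPf cw) /=.
  by rewrite cobb_douglas_expR // -expRN lnM ?posrE ?expR_gt0 // expRK.
move: Da Db => /set_mem Da /set_mem Db /set_mem Dab.
rewrite !lnE // convRE convE.
under eq_bigr do rewrite !mxE mulrDl -!mulrA.
by rewrite big_split /= -!big_distrr /= /unstable.onem; lra.
Qed.

Lemma maxmin_leontief y : orthant y ->
  maxmin_attained leontief_weights (weighted_product y) /\
  maxmin leontief_weights (weighted_product y) = (u y)%:E.
Proof.
move=> y0.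
have minE x r : (exists2 w, simplex w &
    weighted_product y (leontief_weight x) w = r) ->
    (forall w, simplex w -> (r <= weighted_product y (leontief_weight x) w)%E) ->
    min_simplex (weighted_product y) (leontief_weight x) = r.
  move=> [w sw <-] minw; apply: le_anti; apply/andP; split.
    by apply: ereal_inf_lbound; exists w.
  by apply: le_ereal_inf_tmp => _ [w' sw' <-]; exact: minw.
have [c Cc cE] : exists2 c, leontief_weights c &
    min_simplex (weighted_product y) c = (u y)%:E.
  have uy0 := welfare_ge0 wu y0.
  move: (uy0); rewrite le_eqVlt => /orP[/eqP uy|uy].
    (* If [u y = 0], then [y] generates no weight, but any other one attains the value: its minimum
       lies between 0 and [u y]. *)
    have [_ [x [x0 ux] _]] := leontief_weights_nonempty.
    exists (leontief_weight x); first by exists x.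
    have [r [r0 rux _ w1 w2]] := leontief_weightP x0 ux y0.
    rewrite (minE _ _ w1 w2) -uy; congr EFin.
    by apply: le_anti; rewrite mulr_ge0 ?(ltW ux) // andbT uy.
  exists (leontief_weight y); first by exists y.
  have [r [r0 rux r1 w1 w2]] := leontief_weightP y0 uy y0.
  by rewrite (minE _ _ w1 w2) r1 // mul1r.
have maxE : maxmin leontief_weights (weighted_product y) = (u y)%:E.
  apply: le_anti; apply/andP; split; last first.
    by rewrite -cE; apply: ereal_sup_ubound; exists c.
  apply: ge_ereal_sup => _ [_ [x [x0 ux] <-] <-].
  have [r [r0 rux _ w1 w2]] := leontief_weightP x0 ux y0.
  by rewrite (minE _ _ w1 w2) lee_fin.
split => //; split; last by exists c => //; rewrite cE maxE.
move=> _ [x [x0 ux] <-].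
have [r [r0 rux _ w1 w2]] := leontief_weightP x0 ux y0.
by rewrite (minE _ _ w1 w2).
Qed.

(** At the vector of ones the weighted product is the weight itself. *)
Lemma maxmin_leontief_ones :
  maxmin_attained leontief_weights (fun c w => c w) /\
  maxmin leontief_weights (fun c w => c w) = 1%E.
Proof.
have -> : (fun c w => c w) = weighted_product (const_mx 1 : vec).
  by apply/funext => c; apply/funext => w; rewrite weighted_product_ones.
have [? ->] := maxmin_leontief (orthant_const ler01).
by rewrite (welfare_ones wu).
Qed.

End Representation.
(** * The welfare function revealed by a solution *)

Section Revealed.
Context {R : realType} {n : nat}.
Local Notation vec := 'rV[R]_n.
Implicit Types (x y z : vec) (S : set vec) (d t s : R).

Lemma boxZ x d : 0 < d -> [set d *: y | y in box x] = box (d *: x).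
Proof.
move=> d0; apply/seteqP; split => [_ [y [y0 yx] <-]|y [y0 yx]].
  split; first by apply: orthantZ y0 _; exact: ltW.
  by move=> i; rewrite !mxE ler_pM2l.
exists (d^-1 *: y); last by rewrite scalerA divff ?gt_eqF // scale1r.
split; first by apply: orthantZ y0 _; rewrite invr_ge0 ltW.
by move=> i; have := yx i; rewrite !mxE ler_pdivrMl.
Qed.

Lemma box_sub x y : vle x y -> box x `<=` box y.
Proof. by move=> xy z [z0 zx]; split => //; apply: vle_trans xy. Qed.

(** The nearby point is [a] truncated at [x] in every coordinate. *)
Lemma box_near x y d (a : vec) : orthant x -> 0 <= d -> vle y (x + const_mx d) ->
  box y a -> exists2 b, box x b & forall i, `|a 0 i - b 0 i| <= d.
Proof.
move=> x0 d0 yx [a0 ay]; exists (\row_i Num.min (a 0 i) (x 0 i)).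
  by split => i; rewrite mxE ?le_min ?a0 ?x0 // ge_min lexx orbT.
move=> i; rewrite mxE; have := ay i; have := yx i; rewrite !mxE => yxi ayi.
have [_|xa] := leP (a 0 i) (x 0 i); first by rewrite subrr normr0.
by rewrite gtr0_norm; lra.
Qed.

Lemma vle_const t s : t <= s -> vle (const_mx t : vec) (const_mx s).
Proof. by move=> ts i; rewrite !mxE. Qed.

Lemma vll_const t s : t < s -> vll (const_mx t : vec) (const_mx s).
Proof. by move=> ts i; rewrite !mxE. Qed.

(** For [x] in the orthant, this is the comprehensive hull of [x] and [(t, ..., t)], in which [x] is
    tested against equal shares. *)
Definition cube_box x t := box (const_mx t) `|` box x.

Variable F : set vec -> set vec.
Hypotheses (n0 : (0 < n)%N) (hF : solution F).
Hypotheses (paretoF : intermediate_pareto F) (homogF : homogeneity F)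
  (anonF : anonymity F) (contF : continuity F) (iiaF : iia F).

Lemma problem_cube_box x t : 0 < t -> problem (cube_box x t).
Proof.
by move=> t0; apply: problem_setU_box; apply: problem_box => // i; rewrite mxE.
Qed.

Lemma cube_box_const x t : 0 < t -> cube_box x t (const_mx t).
Proof. by move=> t0; left; apply: box_corner; apply: orthant_const; exact: ltW. Qed.

Lemma cube_box_vec x t : orthant x -> cube_box x t x.
Proof. by move=> x0; right; exact: box_corner. Qed.

Lemma cube_boxS S x t : problem S -> S (const_mx t) -> S x -> cube_box x t `<=` S.
Proof.
move=> [_ So _ Sc _] St Sx y [] [y0 yz]; first exact: Sc (So _ St) y0 St yz.
exact: Sc (So _ Sx) y0 Sx yz.
Qed.

Lemma iia_cube_box S x t z : problem S -> 0 < t -> S (const_mx t) -> S x ->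
  F S z -> cube_box x t z -> F (cube_box x t) = cube_box x t `&` F S.
Proof.
move=> pS t0 St Sx FSz xtz; apply: iiaF => //; first exact: problem_cube_box.
  exact: cube_boxS.
by exists z.
Qed.

(** This is how the second half of intermediate Pareto is used: if such a [z] lies in a box whose
    corner is in [S], it is that corner. *)
Lemma choose_pareto S : problem S -> exists2 z, F S z &
  forall y, S y -> vle z y -> z = y.
Proof.
move=> /paretoF [_ [z Fz nz]]; exists z => // y Sy zy.
exact: undominated_box Sy zy nz.
Qed.

Lemma not_chosen S x y : problem S -> S y -> vll x y -> ~ F S x.
Proof. by move=> /paretoF [wp _] Sy xy Fx; apply: wp Fx _; exists y. Qed.

Lemma choose_cube_box x t : orthant x -> 0 < t ->
  F (cube_box x t) (const_mx t) \/ F (cube_box x t) x.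
Proof.
move=> x0 t0; have pD := problem_cube_box x t0.
have [z Fz zmax] := choose_pareto pD; have [_ FS] := hF pD.
have [[z0 zx]|[z0 zx]] : box (const_mx t) z \/ box x z := FS z Fz.
  by left; move: Fz; rewrite (zmax _ (cube_box_const x t0) zx).
by right; move: Fz; rewrite (zmax _ (cube_box_vec t x0) zx).
Qed.

(** If [x] were chosen against the larger cube, IIA would carry the choice of [(t, ..., t)] to the
    larger problem, where [(s, ..., s)] strictly dominates it. *)
Lemma choose_cube_box_incr x t s : orthant x -> 0 < t -> t < s ->
  F (cube_box x t) (const_mx t) -> ~ F (cube_box x s) x.
Proof.
move=> x0 t0 ts Ft Fx; have s0 := lt_trans t0 ts.
have pD := problem_cube_box x s0.
have Dt : cube_box x s (const_mx t).
  left; split; first by apply: orthant_const; exact: ltW.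
  by apply: vle_const; exact: ltW.
move: Ft; rewrite (iia_cube_box pD t0 Dt (cube_box_vec s x0) Fx).
  by move=> [_]; apply: not_chosen (vll_const ts) => //; exact: cube_box_const.
exact: cube_box_vec.
Qed.

(** If [x] is never chosen, the set is empty and its [sup] is 0, which is the intended value. *)
Definition revealed_welfare x :=
  sup [set t | 0 < t /\ F (cube_box x t) x].

Local Notation u := revealed_welfare.

Lemma revealed_welfare_has_ubound x : orthant x ->
  has_ubound [set t | 0 < t /\ F (cube_box x t) x].
Proof.
move=> x0; exists (1 + \sum_i x 0 i) => t [t0 Fx].
rewrite leNgt; apply/negP => xt.
apply: not_chosen (cube_box_const x t0) _ Fx; first exact: problem_cube_box.
move=> i; rewrite mxE; apply: lt_trans xt; rewrite (bigD1 i) //=.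
have : 0 <= \sum_(j | j != i) x 0 j by apply: sumr_ge0.
by lra.
Qed.

Lemma revealed_welfare_ge0 x : orthant x -> 0 <= u x.
Proof.
move=> x0; have [[t [t0 Ft]]|noB] := pselect
  ([set t | 0 < t /\ F (cube_box x t) x] !=set0).
  apply: le_trans (ltW t0) _; apply: ub_le_sup => //.
  exact: revealed_welfare_has_ubound.
by rewrite /u (_ : [set t | _] = set0) ?sup0 //; exact/nonemptyPn.
Qed.

Lemma lt_revealed_welfare x t : orthant x -> 0 < t -> t < u x ->
  F (cube_box x t) x /\ ~ F (cube_box x t) (const_mx t).
Proof.
move=> x0 t0 tu.
have [s [s0 Fs] ts] : exists2 s, [set t | 0 < t /\ F (cube_box x t) x] s & t < s.
  apply: contrapT => nos; move: tu; apply/negP; rewrite -leNgt.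
  have [[s Bs]|noB] := pselect ([set t | 0 < t /\ F (cube_box x t) x] !=set0).
    apply: ge_sup; first by exists s.
    by move=> r Br; rewrite leNgt; apply/negP => tr; apply: nos; exists r.
  by rewrite /u (_ : [set t | _] = set0) ?sup0 ?ltW //; exact/nonemptyPn.
have nA : ~ F (cube_box x t) (const_mx t).
  by move=> /(choose_cube_box_incr x0 t0 ts).
by split => //; case: (choose_cube_box x0 t0).
Qed.

Lemma gt_revealed_welfare x t : orthant x -> 0 < t -> u x < t ->
  F (cube_box x t) (const_mx t) /\ ~ F (cube_box x t) x.
Proof.
move=> x0 t0 ut.
have nB : ~ F (cube_box x t) x.
  move=> Fx; move: ut; apply/negP; rewrite -leNgt; apply: ub_le_sup => //.
  exact: revealed_welfare_has_ubound.
by split => //; case: (choose_cube_box x0 t0).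
Qed.

(** The form in which continuity is used: [S] is enlarged by boxes whose corners decrease to [y] at
    rate [d / (k + 1)]. *)
Lemma choose_limit S y (y_ : nat -> vec) d : problem S -> S y -> 0 <= d ->
  (forall k, vle y (y_ k)) ->
  (forall k, vle (y_ k) (y + const_mx (d * harmonic k))) ->
  (forall k, F (S `|` box (y_ k)) (y_ k)) -> F S y.
Proof.
move=> pS Sy d0 yy_ y_y Fy; have [Sn So Sk Sc Sp] := pS; have y0 := So _ Sy.
have h0 k : 0 < (harmonic k : R) by rewrite /harmonic /= invr_gt0.
(* The rate [d + 1] instead of [d] keeps the bounds positive and strict, even for [d = 0]. *)
have e0 k : 0 < (d + 1) * (harmonic k : R) by rewrite mulr_gt0 //; lra.
have ecvg : (d + 1) * (harmonic k : R) @[k --> \oo] --> 0.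
  rewrite -[X in _ --> X](mulr0 (d + 1)).
  by apply: cvgM; [exact: cvg_cst|exact: cvg_harmonic].
have de k : d * harmonic k < (d + 1) * (harmonic k : R) by rewrite ltr_pM2r //; lra.
apply: contF => //; exists (fun k => S `|` box (y_ k)), y_; split.
- by move=> k; apply: problem_setU_box.
- exact: Fy.
- apply: (hausdorff_dist_cvg0 Sn _ e0 ecvg); first by move=> k z; left.
  move=> k a [Sa|ya]; first by exists a => // i; rewrite subrr normr0.
  have [b [b0 yb] ab] := box_near y0 (mulr_ge0 d0 (ltW (h0 k))) (y_y k) ya.
  exists b; first exact: Sc y0 b0 Sy yb.
  by move=> i; apply: le_lt_trans (ab i) _.
apply/cvg_ballP => r r0.
have : \forall k \near \oo, (d + 1) * (harmonic k : R) < r by exact: cvgr_lt ecvg _ r0.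
apply: filterS => k kr; split => // i j; rewrite [i]ord1 /ball /=.
apply: lt_trans kr; apply: le_lt_trans (de k).
have := yy_ k j; have := y_y k j; rewrite !mxE => h1 h2.
by rewrite ler0_norm ?opprB; lra.
Qed.

Lemma cube_boxZ x t d : 0 < d ->
  [set d *: y | y in cube_box x t] = cube_box (d *: x) (d * t).
Proof.
move=> d0; rewrite /cube_box image_setU !boxZ //; congr (box _ `|` _).
by apply/rowP => i; rewrite !mxE.
Qed.

Lemma choose_cube_boxZ x t d : 0 < t -> 0 < d -> F (cube_box x t) x ->
  F (cube_box (d *: x) (d * t)) (d *: x).
Proof.
move=> t0 d0 Fx; rewrite -cube_boxZ // homogF //; last exact: problem_cube_box.
by exists x.
Qed.

(** Both choices are limits from the decided side: slightly larger cubes beat [x], and by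
    homogeneity slight enlargements of [x] beat the cube of side [u x]. *)
Lemma revealed_welfare_indifferent x : orthant x -> 0 < u x ->
  F (cube_box x (u x)) (const_mx (u x)) /\ F (cube_box x (u x)) x.
Proof.
move=> x0 u0; have pD := problem_cube_box x u0.
have h0 k : 0 < (harmonic k : R) by rewrite /harmonic /= invr_gt0.
split.
  apply: (@choose_limit _ _ (fun k => const_mx (u x + harmonic k)) 1) => //.
  - exact: cube_box_const.
  - by move=> k; apply: vle_const; rewrite lerDl ltW.
  - by move=> k i; rewrite !mxE mul1r.
  move=> k; have uh : u x < u x + harmonic k by rewrite ltrDl.
  rewrite (_ : _ `|` _ = cube_box x (u x + harmonic k)).
    by have [] := gt_revealed_welfare x0 (lt_trans u0 uh) uh.
  rewrite /cube_box setUAC; congr (_ `|` _); apply/setUidPr.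
  by apply: box_sub; apply: vle_const; exact: ltW.
pose M := \sum_i x 0 i.
have M0 : 0 <= M by apply: sumr_ge0.
apply: (@choose_limit _ _ (fun k => (1 + harmonic k) *: x) M) => //.
- exact: cube_box_vec.
- by move=> k i; rewrite mxE mulrDl mul1r lerDl mulr_ge0 // ltW.
- move=> k i; rewrite !mxE mulrDl mul1r lerD2l mulrC ler_wpM2r //; first exact: ltW.
  by rewrite /M (bigD1 i) //= lerDl sumr_ge0.
move=> k; have k1 : 0 < 1 + (harmonic k : R) by rewrite addr_gt0.
rewrite (_ : _ `|` _ = cube_box ((1 + harmonic k) *: x) (u x)).
  have uk : 0 < u x / (1 + harmonic k) by rewrite divr_gt0.
  have ukx : u x / (1 + harmonic k) < u x.
    by rewrite ltr_pdivrMr // ltr_pMr // ltrDl.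
  have := choose_cube_boxZ uk k1 (lt_revealed_welfare x0 uk ukx).1.
  by rewrite [_ * (_ / _)]mulrC divfK ?gt_eqF.
rewrite /cube_box -setUA; congr (_ `|` _); apply/setUidPr; apply: box_sub.
by move=> i; rewrite mxE mulrDl mul1r lerDl mulr_ge0 // ltW.
Qed.

(** * Comparing the points of a problem through an added cube *)

Lemma setU_cube_const S t : 0 < t -> (S `|` box (const_mx t)) (const_mx t).
Proof. by move=> t0; right; apply: box_corner; apply: orthant_const; exact: ltW. Qed.

Lemma iia_setU_box S x y : problem S -> F (S `|` box x) y -> S y ->
  F S = S `&` F (S `|` box x).
Proof.
move=> pS Fy Sy; apply: iiaF => //; first exact: problem_setU_box.
by exists y.
Qed.

Lemma choose_setU_box S t : problem S -> 0 < t ->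
  F (S `|` box (const_mx t)) (const_mx t) \/
  exists2 z, F (S `|` box (const_mx t)) z & S z.
Proof.
move=> pS t0; have pE := problem_setU_box (const_mx t) pS.
have [z Fz zmax] := choose_pareto pE; have [_ FS] := hF pE.
have [Sz|[z0 zt]] : S z \/ box (const_mx t) z := FS z Fz; first by right; exists z.
by left; move: Fz; rewrite (zmax _ (setU_cube_const S t0) zt).
Qed.

(** Suppose [u x < t < u y] and add the cube of side [t] to [S]. If its corner is chosen, IIA makes
    it chosen against [y], although [t < u y]. Otherwise a point of [S] is still chosen, hence so is
    [x], and IIA makes [x] chosen against the cube, although [u x < t]. *)
Lemma chosen_max S x y : problem S -> F S x -> S y -> u y <= u x.
Proof.
move=> pS Fx Sy; have [_ FS] := hF pS; have Sx := FS _ Fx.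
have [_ So _ _ _] := pS; have x0 := So _ Sx; have y0 := So _ Sy.
rewrite leNgt; apply/negP => uxy; have ux0 := revealed_welfare_ge0 x0.
pose t := (u x + u y) / 2.
have t0 : 0 < t by rewrite /t; lra.
have xt : u x < t by rewrite /t; lra.
have ty : t < u y by rewrite /t; lra.
have pE := problem_setU_box (const_mx t) pS.
have Et := setU_cube_const S t0.
case: (choose_setU_box pS t0) => [Ft|[z Fz Sz]].
  have [_] := lt_revealed_welfare y0 t0 ty; apply.
  have Ey : (S `|` box (const_mx t)) y by left.
  rewrite (iia_cube_box pE t0 Et Ey Ft); last exact: cube_box_const.
  by split => //; exact: cube_box_const.
have [_] := gt_revealed_welfare x0 t0 xt; apply.
have Ex : (S `|` box (const_mx t)) x by left.
move: Fx; rewrite (iia_setU_box pS Fz Sz) => -[_ Fx].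
rewrite (iia_cube_box pE t0 Et Ex Fx); last exact: cube_box_vec.
by split => //; exact: cube_box_vec.
Qed.

(** The added cube has side exactly [u y], so that indifference passes the choice from a chosen [x]
    to the corner of the cube, and from there to [y]. Positivity of [u y] makes this cube
    available. *)
Lemma max_chosen_gt0 S y : problem S -> S y -> 0 < u y ->
  (forall z, S z -> u z <= u y) -> F S y.
Proof.
move=> pS Sy uy0 ymax; have [[x Fx] FS] := hF pS; have Sx := FS _ Fx.
have [_ So _ _ _] := pS; have x0 := So _ Sx; have y0 := So _ Sy.
have uxy : u x = u y.
  by apply: le_anti; rewrite ymax //=; exact: chosen_max Fx Sy.
have pE := problem_setU_box (const_mx (u y)) pS.
have Et := setU_cube_const S uy0.
have Ey : (S `|` box (const_mx (u y))) y by left.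
have Ft : F (S `|` box (const_mx (u y))) (const_mx (u y)).
  (* If a point of [S] is chosen from the union, then so is [x]; being indifferent to [x], the
     corner is chosen too. *)
  case: (choose_setU_box pS uy0) => // -[z Fz Sz].
  move: Fx; rewrite (iia_setU_box pS Fz Sz) => -[_ Fx].
  have Ex : (S `|` box (const_mx (u y))) x by left.
  have [] := revealed_welfare_indifferent x0; first by rewrite uxy.
  rewrite uxy (iia_cube_box pE uy0 Et Ex Fx); last exact: cube_box_vec.
  by move=> [].
have [_] := revealed_welfare_indifferent y0 uy0.
rewrite (iia_cube_box pE uy0 Et Ey Ft); last exact: cube_box_const.
by move=> [_ Fy]; rewrite (iia_setU_box pS Fy Sy).
Qed.

(** * Normalization, monotonicity and homogeneity of revealed welfare *)

Lemma revealed_welfare_const t : 0 < t -> u (const_mx t) = t.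
Proof.
move=> t0; have t0' : orthant (const_mx t : vec) by apply: orthant_const; exact: ltW.
have u0 := revealed_welfare_ge0 t0'.
have [ut|tu|//] := ltgtP (u (const_mx t)) t.
  pose s := (u (const_mx t) + t) / 2.
  have s0 : 0 < s by rewrite /s; lra.
  have us : u (const_mx t) < s by rewrite /s; lra.
  have st : s < t by rewrite /s; lra.
  have [Fs _] := gt_revealed_welfare t0' s0 us.
  by case: (not_chosen (problem_cube_box _ s0) (cube_box_vec s t0') (vll_const st) Fs).
pose s := (u (const_mx t) + t) / 2.
have s0 : 0 < s by rewrite /s; lra.
have su : s < u (const_mx t) by rewrite /s; lra.
have ts : t < s by rewrite /s; lra.
have [Fs _] := lt_revealed_welfare t0' s0 su.
by case: (not_chosen (problem_cube_box _ s0) (cube_box_const _ s0) (vll_const ts) Fs).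
Qed.

(** If [u y < t < u x], the corner of the cube of side [t] is chosen against [y]; but [x] is
    feasible there, being below [y], and has larger welfare than the corner. *)
Lemma revealed_welfare_mono x y : orthant x -> vle x y -> u x <= u y.
Proof.
move=> x0 xy; have y0 := orthant_vle x0 xy; have uy0 := revealed_welfare_ge0 y0.
rewrite leNgt; apply/negP => uyx; pose t := (u x + u y) / 2.
have t0 : 0 < t by rewrite /t; lra.
have yt : u y < t by rewrite /t; lra.
have [Ft _] := gt_revealed_welfare y0 t0 yt.
have Dx : cube_box y t x by right.
have := chosen_max (problem_cube_box y t0) Ft Dx.
by rewrite revealed_welfare_const // /t; lra.
Qed.

Lemma revealed_welfareZ_ge x d : orthant x -> 0 < d -> d * u x <= u (d *: x).
Proof.
move=> x0 d0; have dx0 := orthantZ x0 (ltW d0).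
have u0 := revealed_welfare_ge0 dx0.
rewrite leNgt; apply/negP => ud; pose t := (u (d *: x) + d * u x) / 2.
have t0 : 0 < t by rewrite /t; lra.
have dt : u (d *: x) < t by rewrite /t; lra.
have td0 : 0 < t / d by rewrite divr_gt0.
have td : t / d < u x by rewrite ltr_pdivrMr // mulrC /t; lra.
have [Fx _] := lt_revealed_welfare x0 td0 td.
have [_] := gt_revealed_welfare dx0 t0 dt; apply.
by have := choose_cube_boxZ td0 d0 Fx; rewrite [_ * (_ / _)]mulrC divfK ?gt_eqF.
Qed.

Lemma revealed_welfareZ x d : orthant x -> 0 < d -> u (d *: x) = d * u x.
Proof.
move=> x0 d0; apply: le_anti; rewrite revealed_welfareZ_ge // andbT.
have dV0 : 0 < d^-1 by rewrite invr_gt0.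
have := revealed_welfareZ_ge (orthantZ x0 (ltW d0)) dV0.
by rewrite scalerA mulVf ?gt_eqF // scale1r ler_pdivrMl.
Qed.

(** * Symmetry of revealed welfare *)

Definition perm_hull x t := \bigcup_(pi : 'S_n) cube_box (col_perm pi x) t.

Lemma problem_perm_hull x t : 0 < t -> problem (perm_hull x t).
Proof.
move=> t0; have pD (pi : 'S_n) := problem_cube_box (col_perm pi x) t0.
split.
- by exists (const_mx t), 1%g => //; exact: cube_box_const.
- by move=> y [pi _ Dy]; have [_ So _ _ _] := pD pi; exact: So.
- rewrite (_ : perm_hull x t = \big[setU/set0]_(pi <- enum {perm 'I_n})
      cube_box (col_perm pi x) t).
    by apply: bigsetU_compact => pi _; have [] := pD pi.
  rewrite -bigcup_seq; apply: eq_bigcupl; split => pi //= _.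
  by rewrite mem_enum.
- move=> y z y0 z0 [pi _ Dy] zy; exists pi => //.
  by have [_ _ _ Sc _] := pD pi; exact: Sc Dy zy.
- move=> i; have [_ _ _ _ /(_ i)[y Dy yi]] := pD 1%g.
  by exists y => //; exists 1%g.
Qed.

Lemma symmetric_perm_hull x t : symmetric_set (perm_hull x t).
Proof.
have sub pi y : perm_hull x t y -> perm_hull x t (col_perm pi y).
  move=> [sg _ Dy]; exists (pi * sg)%g => //.
  case: Dy => -[y0 yx]; [left|right]; split; try exact: orthant_perm.
    by move=> i; have := yx (pi i); rewrite !mxE.
  by move=> i; have := yx (pi i); rewrite !mxE permM.
move=> pi; apply/seteqP; split => [y Dy|_ [y Dy <-]]; last exact: sub.
by exists (col_perm pi^-1%g y); [exact: sub|rewrite col_permKV].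
Qed.

(** If [u (col_perm pi x) < t < u x], the corner of the cube is not chosen from the symmetric hull,
    so some permutation of [x] is. Anonymity then selects [col_perm pi x], although [x] is available
    and has larger welfare. *)
Lemma revealed_welfare_perm_le x (pi : 'S_n) : orthant x ->
  u x <= u (col_perm pi x).
Proof.
move=> x0; have px0 := orthant_perm pi x0; have up0 := revealed_welfare_ge0 px0.
rewrite leNgt; apply/negP => ux; pose t := (u x + u (col_perm pi x)) / 2.
have t0 : 0 < t by rewrite /t; lra.
have tx : t < u x by rewrite /t; lra.
have pH := problem_perm_hull x t0.
have Hx (sg : 'S_n) : perm_hull x t (col_perm sg x).
  by exists sg => //; apply: cube_box_vec; exact: orthant_perm.
have H1 : perm_hull x t x by have := Hx 1%g; rewrite col_perm1.
have Ht : perm_hull x t (const_mx t) by exists 1%g => //; exact: cube_box_const.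
have [z Fz zmax] := choose_pareto pH; have [_ FS] := hF pH.
have [sg _ [] [z0 zx]] := FS z Fz.
  have := chosen_max pH Fz H1.
  by rewrite (zmax _ Ht zx) revealed_welfare_const // leNgt tx.
(* The permutation [pi * sg^-1] takes [col_perm sg x] to [col_perm pi x]. *)
have := anonF pH (symmetric_perm_hull x t) Fz (pi * sg^-1)%g.
rewrite (zmax _ (Hx sg) zx) -col_permM mulgKV => Fpi.
by have := chosen_max pH Fpi H1; rewrite leNgt ux.
Qed.

Lemma revealed_welfareP : welfare u.
Proof.
split.
- exact: revealed_welfare_ge0.
- exact: revealed_welfare_mono.
- exact: revealed_welfareZ.
- move=> x pi x0; apply: le_anti; rewrite revealed_welfare_perm_le // andbT.
  have := revealed_welfare_perm_le pi^-1%g (orthant_perm pi x0).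
  by rewrite col_permVK.
- exact: revealed_welfare_const.
Qed.

Lemma choose_argmax S : problem S -> F S = argmax S (fun x => (u x)%:E).
Proof.
move=> pS; have [_ So _ _ _] := pS.
apply/seteqP; split => [x Fx|y /welfare_argmaxP [Sy ymax]].
  apply/welfare_argmaxP; split => [|y Sy]; last exact: chosen_max Fx Sy.
  by have [_] := hF pS; apply.
have y0 := So _ Sy; have := revealed_welfare_ge0 y0.
rewrite le_eqVlt => /orP[/eqP uy|uy]; last exact: max_chosen_gt0 pS Sy uy ymax.
(* The maximum on [S] is 0 here. Moving [y] up by [1 / (k + 1)] makes its welfare positive, hence
   maximal once its box is added to [S], and [choose_limit] brings the choice back to [y]. *)
have h0 k : 0 < (harmonic k : R) by rewrite /harmonic /= invr_gt0.
apply: (@choose_limit _ _ (fun k => y + const_mx (harmonic k)) 1) => //.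
- by move=> k; apply: vle_shift; exact: ltW.
- by move=> k; rewrite mul1r.
move=> k; set yk := y + _.
have yk0 : orthant yk by apply: orthant_vle y0 _; apply: vle_shift; exact: ltW.
have uyk : harmonic k <= u yk.
  rewrite -[leLHS](revealed_welfare_const (h0 k)).
  apply: revealed_welfare_mono; first by apply: orthant_const; exact: ltW.
  by move=> i; rewrite !mxE lerDr.
apply: max_chosen_gt0; first exact: problem_setU_box.
- by right; exact: box_corner.
- exact: lt_le_trans uyk.
move=> z [Sz|[z0 zy]]; last exact: revealed_welfare_mono.
by apply: le_trans (ymax _ Sz) _; rewrite -uy; exact: revealed_welfare_ge0.
Qed.

End Revealed.

(** * Equivalence of the axioms and the max-min representation *)

Theorem theorem2 (R : realType) (n : nat) (hn : (2 <= n)%N)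
    (F : set 'rV[R]_n -> set 'rV[R]_n) (hF : solution F) :
  [/\ intermediate_pareto F, homogeneity F, anonymity F, continuity F & iia F]
  <->
  exists C : set ('rV[R]_n -> \bar R),
    [/\ C !=set0,
        symmetric_collection C,
        forall c, C c -> positive_weight c /\ log_convex c,
        maxmin_attained C (fun c w => c w) /\
          maxmin C (fun c w => c w) = 1%E &
        forall S, problem S ->
          (forall x, S x -> maxmin_attained C (weighted_product x)) /\
          F S = argmax S (fun x => maxmin C (weighted_product x))].
Proof.
have n0 : (0 < n)%N by exact: ltnW.
split=> [[paretoF homogF anonF contF iiaF]|[C [C0 symC posC [_ C1] FC]]].
  have wu := revealed_welfareP n0 hF paretoF homogF anonF iiaF.
  exists (leontief_weights (revealed_welfare F)); split.
  - exact: leontief_weights_nonempty.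
  - exact: leontief_weights_symmetric.
  - move=> _ [x [x0 ux] <-]; split; first exact: leontief_weight_positive.
    exact: leontief_weight_log_convex.
  - exact: maxmin_leontief_ones.
  move=> S pS; have [_ So _ _ _] := pS; split => [x /So x0|].
    by have [] := maxmin_leontief wu x0.
  rewrite (choose_argmax n0 hF paretoF homogF contF iiaF pS).
  apply: eq_argmax => x /So x0.
  by have [_ ->] := maxmin_leontief wu x0.
have pos c : C c -> positive_weight c by move=> /posC [].
have wu := maxmin_welfare C0 symC pos C1.
have FE S (pS : problem S) :
    F S = argmax S (fun x => (fine (maxmin C (weighted_product x)))%:E).
  by rewrite (FC S pS).2; exact: argmax_maxmin_fine.
split.
- exact: argmax_pareto FE.
- exact: argmax_homogeneity FE.
- exact: argmax_anonymity FE.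
- exact: argmax_continuity FE.
- exact: argmax_iia FE.
Qed.
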